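(* Let $R$ be a $\ast$-ring. The following statements are equivalent: (1) $R$ is nil-$\ast$-reversible. (2) For all $a\in N(R)$ and $b\in R$, $ab\in E(R)$ implies that $ab^{\ast}=b^{\ast}a\in E(R)$. (3) For all $a\in N(R)$ and $b\in R$, $ab\in P(R)$ implies that $ab^{\ast}=b^{\ast}a\in P(R)$.
   Context: All rings are associative with unity. A $\ast$-ring is a ring $R$ equipped with an involution $\ast$, i.e. a map $\ast:R\to R$ with $(x+y)^{\ast}=x^{\ast}+y^{\ast}$, $(xy)^{\ast}=y^{\ast}x^{\ast}$ and $(x^{\ast})^{\ast}=x$ for all $x,y\in R$. $N(R)$ is the set of nilpotent elements, $E(R)$ the set of idempotents, and $P(R)$ the set of projections of $R$, i.e. elements $p$ with $p=p^{2}=p^{\ast}$. A $\ast$-ring $R$ is nil-$\ast$-reversible if for all $a\in N(R)$ and $b\in R$, $ab=0$ implies $ab^{\ast}=b^{\ast}a=0$. *)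

(* Defs.v *)
From HB Require Import structures.
From mathcomp Require Import all_boot all_algebra.

Set Implicit Arguments.
Unset Strict Implicit.
Unset Printing Implicit Defensive.

Import GRing.Theory.
Local Open Scope ring_scope.

(* The base structure is pzRingType, so the zero ring is allowed. *)
HB.mixin Record PzRing_hasInvolution R & GRing.PzRing R := {
  star : R -> R;
  starD : forall x y : R, star (x + y) = star x + star y;
  starM : forall x y : R, star (x * y) = star y * star x;
  starK : forall x : R, star (star x) = x
}.

#[short(type="starRingType")]
HB.structure Definition StarRing :=
  { R of PzRing_hasInvolution R & GRing.PzRing R }.

Definition nilpotent_elt (R : pzRingType) (a : R) : Prop :=
  exists n : nat, a ^+ n = 0.

Definition idempotent_elt (R : pzRingType) (e : R) : Prop := e = e * e.

Definition projection (R : starRingType) (p : R) : Prop :=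
  p = p * p /\ p = star p.

Definition nil_star_reversible (R : starRingType) : Prop :=
  forall a b : R, nilpotent_elt a ->
    a * b = 0 -> a * star b = 0 /\ star b * a = 0.

(* Main.v *)
Require Import Defs.
From mathcomp Require Import all_boot all_algebra.

(** When the conditions hold, the idempotents and projections that they mention
    are all zero, so (2) and (3) only rephrase (1).

    If [a] is nilpotent, commutes with [c], and [a * c] is idempotent, then
    [a * c] is both nilpotent and idempotent, hence zero
    ([idempotent_commuting_nilpotent_eq0]).  With [c = star b], the conclusions
    of (2) and (3) amount to [a * star b = star b * a = 0].  As [0] is both an
    idempotent and a projection, this gives (2) => (3) and (3) => (1).

    For (1) => (2) it suffices that an idempotent [e = a * b] with [a] nilpotent
    is zero ([idempotent_nilpotentM_eq0]).  Under nil-star-reversibility, any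
    factor may be inserted in the middle of a vanishing product whose right
    factor is nilpotent ([nil_star_reversible_insert]).  Inserting [b] in
    [(e * a) * a ^+ m = 0] gives [(e * (a * b)) * a ^+ m = e * a ^+ m = 0], so
    the exponent in [e * a ^+ m = 0] can be lowered down to [e * a = 0], and
    then [e = e * (a * b) = 0]. *)

Set Implicit Arguments.
Unset Strict Implicit.

Import GRing.Theory.
Local Open Scope ring_scope.

Lemma star0 (R : starRingType) : star (0 : R) = 0.
Proof. by apply: (addrI (star 0)); rewrite -starD !addr0. Qed.

Lemma star1 (R : starRingType) : star (1 : R) = 1.
Proof. by rewrite -[LHS]mulr1 -{2}[1]starK -starM mulr1 starK. Qed.

Lemma starX (R : starRingType) (a : R) n : star (a ^+ n) = star a ^+ n.
Proof.
by elim: n => [|n IHn]; rewrite ?expr0 ?star1 // exprS starM IHn -exprSr.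
Qed.

Lemma nilpotent_star (R : starRingType) (a : R) :
  nilpotent_elt a -> nilpotent_elt (star a).
Proof. by case=> n an0; exists n; rewrite -starX an0 star0. Qed.

Lemma nilpotentX (R : pzRingType) (a : R) m :
  nilpotent_elt a -> nilpotent_elt (a ^+ m.+1).
Proof.
by case=> n an0; exists n; rewrite -exprM mulnC exprM an0 expr0n.
Qed.

Lemma idempotentX (R : pzRingType) (e : R) n :
  idempotent_elt e -> e ^+ n.+1 = e.
Proof. by move=> ee; elim: n => // n IHn; rewrite exprS IHn -ee. Qed.

(** Commutation gives [(a * c) ^+ n = a ^+ n * c ^+ n], so [a * c] inherits
    nilpotency from [a]. *)
Lemma idempotent_commuting_nilpotent_eq0 (R : pzRingType) (a c : R) :
  nilpotent_elt a -> a * c = c * a -> idempotent_elt (a * c) -> a * c = 0.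
Proof.
move=> [n an0] ac_comm ac_idem.
by rewrite -(idempotentX n ac_idem) exprMn_comm // exprSr an0 !mul0r.
Qed.

(** Applying the hypothesis twice, to [b] and then to [star b], cancels the
    involution. *)
Lemma nil_star_reversibleC (R : starRingType) (a b : R) :
  nil_star_reversible R -> nilpotent_elt a -> a * b = 0 -> b * a = 0.
Proof.
move=> rev a_nil /(rev _ _ a_nil)[/(rev _ _ a_nil)[_]].
by rewrite starK.
Qed.

(** The definition treats only products with a nilpotent left factor; applying
    the involution moves a nilpotent right factor to the left. *)
Lemma nil_star_reversibleC_right (R : starRingType) (a b : R) :
  nil_star_reversible R -> nilpotent_elt a -> b * a = 0 -> a * b = 0.
Proof.
move=> rev a_nil ba0.
have sasb0 : star a * star b = 0 by rewrite -starM ba0 star0.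
have sbsa0 := nil_star_reversibleC rev (nilpotent_star a_nil) sasb0.
by rewrite -[a * b]starK starM sbsa0 star0.
Qed.

(** Once [c * d = 0], also [c * (d * x) = 0], and reversing this last product
    puts [x] between [d] and [c]. *)
Lemma nil_star_reversible_insert (R : starRingType) (c d x : R) :
  nil_star_reversible R -> nilpotent_elt c -> d * c = 0 -> d * x * c = 0.
Proof.
move=> rev c_nil dc0; apply: nil_star_reversibleC => //.
by rewrite mulrA (nil_star_reversibleC_right rev c_nil dc0) mul0r.
Qed.

(** The exponent [m.+1] stays positive during the descent because
    [a ^+ 0 = 1] is not nilpotent; the last step, from [e * a = 0] to [e = 0],
    is a mere multiplication by [b]. *)
Lemma idempotent_nilpotentM_eq0 (R : starRingType) (a b : R) :
  nil_star_reversible R -> nilpotent_elt a -> idempotent_elt (a * b) ->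
  a * b = 0.
Proof.
move=> rev a_nil; have [n an0] := a_nil.
set e := a * b => e_idem.
have descent m : e * a ^+ m.+1 = 0 -> e = 0.
  elim: m => [|m IHm] eam0; first by rewrite e_idem /e mulrA eam0 mul0r.
  apply: IHm; rewrite {1}e_idem {2}/e mulrA.
  apply: nil_star_reversible_insert => //; first exact: nilpotentX.
  by rewrite -mulrA -exprS.
by apply: (descent n); rewrite exprS an0 !mulr0.
Qed.

Theorem proposition4p6 (R : starRingType) :
  [<-> nil_star_reversible R;
       forall a b : R, nilpotent_elt a -> idempotent_elt (a * b) ->
         a * star b = star b * a /\ idempotent_elt (a * star b);
       forall a b : R, nilpotent_elt a -> projection (a * b) ->
         a * star b = star b * a /\ projection (a * star b)].
Proof.
tfae.
- move=> rev a b a_nil /(idempotent_nilpotentM_eq0 rev a_nil) ab0.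
  have [-> ->] := rev _ _ a_nil ab0.
  by rewrite /idempotent_elt mul0r.
- move=> idem a b a_nil [ab_idem _].
  have [comm asb_idem] := idem _ _ a_nil ab_idem.
  split=> //; rewrite /projection.
  rewrite (idempotent_commuting_nilpotent_eq0 a_nil comm asb_idem).
  by rewrite mul0r star0.
- move=> proj a b a_nil ab0.
  have ab_proj : projection (a * b) by rewrite ab0 /projection mul0r star0.
  have [comm [asb_idem _]] := proj _ _ a_nil ab_proj.
  rewrite -comm.
  by rewrite (idempotent_commuting_nilpotent_eq0 a_nil comm asb_idem).
Qed.
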